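(* Let $m,n\ge2$ be integers with $m$ even, and let $\mathcal{A}$ be a real $m$th order $n$-dimensional circulant tensor. If $\mathcal{A}$ is a $\mathrm{B}_0$ tensor, then $\mathcal{A}$ is positive semi-definite. If $\mathcal{A}$ is a $\mathrm{B}$ tensor, then $\mathcal{A}$ is positive definite.
   Context: Write $[n]=\{1,\dots,n\}$. A real $m$th order $n$-dimensional tensor is an array $\mathcal{A}=(a_{j_1\cdots j_m})$ of real numbers indexed by $[n]^m$ (not necessarily symmetric). It is circulant if $a_{j_1\cdots j_m}=a_{k_1\cdots k_m}$ whenever $j_l,k_l\in[n]$ and $k_l\equiv j_l+1 \pmod n$ for all $l\in[m]$. $\mathcal{A}$ is a $\mathrm{B}_0$ tensor if for every $j\in[n]$: $\sum_{j_2,\dots,j_m=1}^n a_{jj_2\cdots j_m}\ge0$, and $\frac1{n^{m-1}}\sum_{j_2,\dots,j_m=1}^n a_{jj_2\cdots j_m}\ge a_{jk_2\cdots k_m}$ for all $(k_2,\dots,k_m)\neq(j,\dots,j)$. It is a $\mathrm{B}$ tensor if all these inequalities are strict. For even $m$, $\mathcal{A}$ is positive semi-definite if $\mathcal{A}\mathbf{x}^m=\sum_{j_1,\dots,j_m=1}^n a_{j_1\cdots j_m}x_{j_1}\cdots x_{j_m}\ge0$ for all $\mathbf{x}\in\mathbb{R}^n$, and positive definite if $\mathcal{A}\mathbf{x}^m>0$ for all $\mathbf{x}\in\mathbb{R}^n\setminus\{\mathbf{0}\}$. *)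

(* Defs.v *)
From mathcomp Require Import all_boot all_order all_algebra.
From mathcomp Require Import reals.

Set Implicit Arguments.
Unset Strict Implicit.
Unset Printing Implicit Defensive.

Import Order.TTheory GRing.Theory Num.Theory.
Local Open Scope ring_scope.

(* The index set {1, ..., n} is rendered as 'I_n = {0, ..., n-1}; the circulant
   condition is invariant under this shift. *)
Definition tensor (R : realType) (m n : nat) : Type :=
  {ffun m.-tuple 'I_n -> R}.

Definition circulant (R : realType) (m n : nat) (A : tensor R m n) : Prop :=
  forall J K : m.-tuple 'I_n,
    (forall l : 'I_m, tnth K l = (tnth J l).+1 %[mod n]) -> A J = A K.

(* The multi-indices (j, j_2, ..., j_m) are the m-tuples J whose head is j;
   [ohead] avoids casting between m and m.-1.+1 (for m = 0 there are none). *)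
Definition row_sum (R : realType) (m n : nat) (A : tensor R m n) (j : 'I_n) : R :=
  \sum_(J : m.-tuple 'I_n | ohead J == Some j) A J.

Definition B0_tensor (R : realType) (m n : nat) (A : tensor R m n) : Prop :=
  forall j : 'I_n,
    0 <= row_sum A j /\
    (forall K : m.-tuple 'I_n, ohead K = Some j -> K <> [tuple of nseq m j] ->
       A K <= (n%:R ^+ m.-1)^-1 * row_sum A j).

Definition B_tensor (R : realType) (m n : nat) (A : tensor R m n) : Prop :=
  forall j : 'I_n,
    0 < row_sum A j /\
    (forall K : m.-tuple 'I_n, ohead K = Some j -> K <> [tuple of nseq m j] ->
       A K < (n%:R ^+ m.-1)^-1 * row_sum A j).

Definition tensor_form (R : realType) (m n : nat) (A : tensor R m n)
    (x : 'rV[R]_n) : R :=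
  \sum_(J : m.-tuple 'I_n) A J * \prod_(l < m) x 0 (tnth J l).

Definition pos_semidefinite (R : realType) (m n : nat) (A : tensor R m n) : Prop :=
  forall x : 'rV[R]_n, 0 <= tensor_form A x.

Definition pos_definite (R : realType) (m n : nat) (A : tensor R m n) : Prop :=
  forall x : 'rV[R]_n, x <> 0 -> 0 < tensor_form A x.

(* Main.v *)
(* Let r be the common row sum of the circulant tensor A and c = r / n^(m-1).
   The tensor B = c - A is circulant with all row sums equal to 0, and by
   circulance the same holds for its slices {K | k_l = i} in every position l.
   Hence B K may be weighted by the mean of the x_(k_l)^m at no cost, and
     A x^m = c (sum_i x_i)^m + sum_K B K (mean_l x_(k_l)^m - prod_l x_(k_l)).
   Every term is nonnegative: the bracket by AM-GM (m is even), and it vanishes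
   on constant K, the only ones for which B K may be negative.  The B case
   reduces to the B0 case by subtracting a small multiple of the identity. *)
Require Import Defs.
From mathcomp Require Import all_boot all_order all_algebra.
From mathcomp Require Import reals.

Set Implicit Arguments.
Unset Strict Implicit.
Unset Printing Implicit Defensive.

Import Order.TTheory GRing.Theory Num.Theory.
Local Open Scope ring_scope.

(** Distributivity, with functions on ['I_m] reindexed as tuples. It identifies the form of the
    all-ones tensor as a power of the sum of coordinates. *)
Lemma sumr_tuple_prod (R : comPzRingType) (T : finType) (m : nat) (f : T -> R) :
  \sum_(J : m.-tuple T) \prod_(l < m) f (tnth J l) = (\sum_i f i) ^+ m.
Proof.
rewrite -[in RHS](card_ord m) -prodr_const.
rewrite (bigA_distr_bigA (fun (_ : 'I_m) i => f i)) /=.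
rewrite (reindex (fun g : {ffun 'I_m -> T} => [tuple g l | l < m])) /=.
  by apply: eq_bigr => g _; apply: eq_bigr => l _; rewrite tnth_mktuple.
exists (fun J => [ffun l => tnth J l]) => [g|J] _.
  by apply/ffunP => l; rewrite ffunE tnth_mktuple.
by apply: eq_from_tnth => l; rewrite tnth_mktuple ffunE.
Qed.

(** AM-GM for the numbers [y l ^+ m], nonnegative because [m] is even: it bounds the [m]th power of
    the absolute value of the product by the [m]th power of the mean. *)
Lemma prod_le_mean_expr (R : realFieldType) (m : nat) (y : 'I_m -> R) :
  (0 < m)%N -> ~~ odd m ->
  \prod_l y l <= m%:R^-1 * \sum_l y l ^+ m.
Proof.
move=> m_gt0 mev.
have ym_ge0 l : 0 <= y l ^+ m by rewrite exprn_even_ge0.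
have mean_ge0 : 0 <= m%:R^-1 * \sum_l y l ^+ m.
  by rewrite mulr_ge0 ?invr_ge0 ?ler0n ?sumr_ge0.
apply: (le_trans (ler_norm _)).
rewrite -(ler_pXn2r m_gt0) ?nnegrE // -normrX -prodrXl.
rewrite ger0_norm ?prodr_ge0 // mulrC.
have [+ _] := @leif_AGM R _ 'I_m (fun l => y l ^+ m) (fun l _ => ym_ge0 l).
by rewrite card_ord.
Qed.

Section SliceSum.
Variables (R : realType) (m n : nat).
Implicit Types (A : tensor R m n) (i j : 'I_n) (l : 'I_m).

Definition slice_sum A l i : R := \sum_(J : m.-tuple 'I_n | tnth J l == i) A J.

Lemma sum_slice_sum A l : \sum_i slice_sum A l i = \sum_J A J.
Proof.
by rewrite [RHS](partition_big (fun J : m.-tuple 'I_n => tnth J l) predT).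
Qed.

(** Shifting every index cyclically is a bijection of multi-indices that preserves the entries of
    [A] and carries slice [i] onto slice [ordS i]. *)
Lemma slice_sum_ordS A l i : circulant A -> slice_sum A l (ordS i) = slice_sum A l i.
Proof.
move=> circA; rewrite /slice_sum.
rewrite (reindex (fun J : m.-tuple 'I_n => map_tuple (@ordS n) J)) /=; last first.
  exists (map_tuple (@ord_pred n)) => J _; apply: eq_from_tnth => l';
  by rewrite !tnth_map ?ordSK ?ord_predK.
apply: eq_big => [J|J _]; first by rewrite tnth_map (can_eq (@ordSK n)).
by apply/esym/circA => l'; rewrite tnth_map /= modn_mod.
Qed.

Lemma slice_sum_const A l i j : circulant A -> slice_sum A l i = slice_sum A l j.
Proof.
move=> circA.
have n_gt0 : (0 < n)%N by exact: leq_ltn_trans (leq0n _) (ltn_ord i).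
suff to0 k : slice_sum A l k = slice_sum A l (Ordinal n_gt0) by rewrite !to0.
case: k => k; elim: k => [|k IHk] ltkn.
  by congr slice_sum; apply: val_inj.
rewrite -(IHk (ltnW ltkn)) -[RHS]slice_sum_ordS //.
by congr slice_sum; apply: val_inj; rewrite /= modn_small.
Qed.

Lemma slice_sum_circulant A l i :
  circulant A -> slice_sum A l i *+ n = \sum_J A J.
Proof.
move=> circA; rewrite -(sum_slice_sum A l).
by rewrite (eq_bigr (fun=> slice_sum A l i)) ?sumr_const ?card_ord // => j _;
   apply: slice_sum_const.
Qed.

Lemma row_sum_slice A (m_gt0 : (0 < m)%N) j :
  row_sum A j = slice_sum A (Ordinal m_gt0) j.
Proof.
by apply: eq_bigl => J; rewrite (tnth_nth j); case: m m_gt0 J => // k ? [[|a s]].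
Qed.

End SliceSum.

Lemma prod_const_tuple (R : realType) (m n : nat) (x : 'rV[R]_n) (j : 'I_n) :
  \prod_(l < m) x 0 (tnth [tuple of nseq m j] l) = x 0 j ^+ m.
Proof.
rewrite (eq_bigr (fun=> x 0 j)) ?prodr_const ?card_ord // => l _.
by rewrite tnth_nseq.
Qed.

Lemma ohead_tuple_gt0 (T : Type) (m : nat) (K : m.-tuple T) :
  (0 < m)%N -> exists j, ohead K = Some j.
Proof. by case: m K => // m [[|a s] //= _] _; exists a. Qed.

Lemma B0_circulant_psd (R : realType) (m n : nat) (A : tensor R m n) :
  (0 < m)%N -> ~~ odd m -> circulant A -> B0_tensor A -> pos_semidefinite A.
Proof.
move=> m_gt0 mev circA B0A x.
case: (posnP n) => [n0|n_gt0].
  rewrite /tensor_form big1 // => J _; exfalso.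
  by case: (tnth J (Ordinal m_gt0)) => k; rewrite n0.
have nR0 : n%:R != 0 :> R by rewrite pnatr_eq0 -lt0n.
have mR0 : m%:R != 0 :> R by rewrite pnatr_eq0 -lt0n.
pose r := row_sum A (Ordinal n_gt0).
have rE j : row_sum A j = r.
  by rewrite /r !(row_sum_slice _ m_gt0); apply: slice_sum_const.
pose c := (n%:R ^+ m.-1)^-1 * r.
have c_ge0 : 0 <= c.
  rewrite mulr_ge0 ?invr_ge0 ?exprn_ge0 ?ler0n //.
  by have [] := B0A (Ordinal n_gt0).
pose B : tensor R m n := [ffun J => c - A J].
have circB : circulant B by move=> J K JK; rewrite !ffunE (circA J K JK).
have sumB : \sum_J B J = 0.
  rewrite (eq_bigr (fun J => c - A J)) => [|J _]; last by rewrite ffunE.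
  rewrite sumrB sumr_const card_tuple card_ord.
  (* The entries of [A] sum to n r, and so do the n^m copies of [c], as n^(m-1) c = r. *)
  rewrite -(slice_sum_circulant (Ordinal m_gt0) (Ordinal n_gt0) circA).
  rewrite -row_sum_slice -/r -(prednK m_gt0) expnS mulnC mulrnA.
  rewrite -mulrnBl -[c *+ _]mulr_natl natrX /c mulrA mulfV ?expf_neq0 //.
  by rewrite mul1r subrr mul0rn.
have sliceB l i : slice_sum B l i = 0.
  have := slice_sum_circulant l i circB; rewrite sumB => /eqP.
  by rewrite -mulr_natr mulf_eq0 (negPf nR0) orbF => /eqP.
pose mean (J : m.-tuple 'I_n) := m%:R^-1 * \sum_(l < m) x 0 (tnth J l) ^+ m.
have sum_mean : \sum_J B J * mean J = 0.
  rewrite /mean (eq_bigr (fun J : m.-tuple 'I_n =>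
    m%:R^-1 * \sum_(l < m) B J * x 0 (tnth J l) ^+ m)) => [|J _]; last first.
    by rewrite mulrCA mulr_sumr.
  rewrite -mulr_sumr exchange_big big1 ?mulr0 //= => l _.
  (* Group by the value [i] of the [l]th index: the power of [x] is constant on each slice and
     factors out of a vanishing slice sum. *)
  rewrite (partition_big (fun J : m.-tuple 'I_n => tnth J l) predT) //= big1 // => i _.
  rewrite (eq_bigr (fun J => B J * x 0 i ^+ m)) => [|J /eqP-> //].
  by rewrite -mulr_suml -/(slice_sum B l i) sliceB mul0r.
have -> : tensor_form A x = c * (\sum_i x 0 i) ^+ m
    + \sum_J B J * (mean J - \prod_(l < m) x 0 (tnth J l)).
  under [X in _ + X]eq_bigr do rewrite mulrBr.
  rewrite sumrB sum_mean sub0r -sumr_tuple_prod mulr_sumr -sumrB.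
  by apply: eq_bigr => J _; rewrite ffunE -mulrBl opprB addrCA subrr addr0.
apply: addr_ge0; first by rewrite mulr_ge0 // exprn_even_ge0.
apply: sumr_ge0 => K _.
have [j headK] := ohead_tuple_gt0 K m_gt0.
(* On a constant [K] the sign of [B K] is unknown, but mean and product are both [x 0 j ^+ m]. *)
have [->|/eqP neK] := eqVneq K [tuple of nseq m j].
  rewrite /mean prod_const_tuple (eq_bigr (fun=> x 0 j ^+ m)) => [|l _].
    by rewrite sumr_const card_ord -[_ ^+ m *+ _]mulr_natl mulKf // subrr mulr0.
  by rewrite tnth_nseq.
apply: mulr_ge0; last by rewrite subr_ge0 prod_le_mean_expr.
rewrite ffunE subr_ge0 /c -(rE j).
by have [_] := B0A j; apply.
Qed.

(** This is [A] minus [e] times the identity tensor; the boolean test for a constant multi-index is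
    coerced to 0 or 1. *)
Definition diag_shift (R : realType) (m n : nat) (e : R) (A : tensor R m n) :
    tensor R m n :=
  [ffun J => A J - e *+ [exists j, J == [tuple of nseq m j]]].

Section DiagShift.
Variables (R : realType) (m n : nat) (A : tensor R m n).
Hypothesis m_gt0 : (0 < m)%N.

Lemma nseq_tuple_inj : injective (fun j : 'I_n => [tuple of nseq m j]).
Proof.
move=> i j /(congr1 (fun J : m.-tuple _ => tnth J (Ordinal m_gt0))).
by rewrite !tnth_nseq.
Qed.

Lemma circulant_diag_shift e : circulant A -> circulant (diag_shift e A).
Proof.
move=> circA J K JK; rewrite !ffunE (circA J K JK).
have KE : K = map_tuple (@ordS n) J.
  apply: eq_from_tnth => l; apply: val_inj.
  by rewrite tnth_map /= -JK modn_small.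
congr (_ - _ *+ (_ : bool)); apply/existsP/existsP => -[j /eqP Ej].
  exists (ordS j); apply/eqP; rewrite KE Ej; apply: eq_from_tnth => l.
  by rewrite tnth_map !tnth_nseq.
exists (ord_pred j); apply/eqP; apply: eq_from_tnth => l.
rewrite tnth_nseq; apply: (can_inj (@ordSK n)).
have := congr1 (fun J : m.-tuple _ => tnth J l) (etrans (esym KE) Ej).
by rewrite tnth_map tnth_nseq ord_predK.
Qed.

(** The general [P] and [F] cover both row sums ([F] constant 1) and the form ([P] always true). *)
Lemma sum_diag_shift (P : pred (m.-tuple 'I_n)) (F : m.-tuple 'I_n -> R) e :
  \sum_(J | P J) diag_shift e A J * F J = \sum_(J | P J) A J * F J
    - e * \sum_(j | P [tuple of nseq m j]) F [tuple of nseq m j].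
Proof.
pose diag (J : m.-tuple 'I_n) := [exists j, J == [tuple of nseq m j]].
rewrite (eq_bigr (fun J => A J * F J - e * (F J *+ diag J))) => [|J _]; last first.
  by rewrite ffunE mulrBl mulrnAl mulrnAr.
rewrite sumrB -mulr_sumr; congr (_ - e * _).
rewrite (eq_bigr (fun J => if diag J then F J else 0)) => [|J _]; last first.
  by case: (diag J).
rewrite -big_mkcondr /=.
rewrite (eq_bigl (fun J => P J && (J \in [set [tuple of nseq m j] | j in 'I_n]))).
  rewrite (eq_bigl (fun J => (J \in [set [tuple of nseq m j] | j in 'I_n]) && P J)).
    rewrite big_mkcondr big_imset => [|i j _ _ /nseq_tuple_inj //].
    by rewrite -big_mkcondr.
  by move=> J; rewrite andbC.
move=> J; congr (_ && _); apply/existsP/imsetP => [[j /eqP->]|[j _ ->]].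
  by exists j.
by exists j.
Qed.

Lemma row_sum_diag_shift e j : row_sum (diag_shift e A) j = row_sum A j - e.
Proof.
have := sum_diag_shift (fun J => ohead J == Some j) (fun=> 1) e.
under eq_bigr do rewrite mulr1.
under [X in _ = X - _]eq_bigr do rewrite mulr1.
rewrite /row_sum => ->; congr (_ - _).
rewrite (eq_bigl (pred1 j)) => [|i]; first by rewrite big_pred1_eq mulr1.
by case: m m_gt0.
Qed.

Lemma tensor_form_diag_shift e x :
  tensor_form (diag_shift e A) x = tensor_form A x - e * \sum_j x 0 j ^+ m.
Proof.
rewrite /tensor_form (sum_diag_shift predT).
by under [X in e * X]eq_bigr do rewrite prod_const_tuple.
Qed.

(** The shift lowers each row sum by [e], hence each row mean by [e / N], and leaves off-diagonal
    entries alone. So [e] may be any positive number below all row sums and below [N] times every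
    gap between a row mean and an off-diagonal entry. *)
Lemma B_tensor_diag_shift :
  B_tensor A -> exists2 e, 0 < e & B0_tensor (diag_shift e A).
Proof.
move=> BA.
pose N : R := n%:R ^+ m.-1.
pose gap j K := N * (N^-1 * row_sum A j - A K).
pose off j (K : m.-tuple 'I_n) := (ohead K == Some j) && (K != [tuple of nseq m j]).
(* The default value 1 keeps the minimum positive even over an empty family. *)
pose e := \big[Num.min/1]_j Num.min (row_sum A j)
            (\big[Num.min/1]_(K | off j K) gap j K).
have N_gt0 (j : 'I_n) : 0 < N.
  by rewrite exprn_gt0 // ltr0n; exact: leq_ltn_trans (leq0n _) (ltn_ord j).
exists e.
  apply/bigmin_gtP; split=> // j _; rewrite lt_min; have [-> BAj] := BA j.
  apply/bigmin_gtP; split=> // K /andP[/eqP hK /eqP nK].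
  by rewrite mulr_gt0 ?(N_gt0 j) // subr_gt0 BAj.
move=> j.
have : e <= Num.min (row_sum A j) (\big[Num.min/1]_(K | off j K) gap j K).
  exact: bigmin_le.
rewrite le_min row_sum_diag_shift => /andP[le_e_row le_e_gap]; split.
  by rewrite subr_ge0.
move=> K hK nK; have offK : off j K by rewrite /off hK eqxx; apply/eqP.
have {}le_e_gap := le_trans le_e_gap (bigmin_le_cond _ _ offK).
have -> : diag_shift e A K = A K.
  rewrite ffunE; case: existsP => [[i /eqP Ki]|_]; last by rewrite subr0.
  case: nK; rewrite Ki; congr [tuple of nseq m _].
  by move: hK; rewrite Ki; case: m m_gt0 => //= ? _ [].
by rewrite -/N mulrBr lerBrDr addrC -lerBrDr ler_pdivrMl // (N_gt0 j).
Qed.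

End DiagShift.

Theorem corollary1 (R : realType) (m n : nat) (hm : (2 <= m)%N) (hn : (2 <= n)%N)
    (hev : ~~ odd m) (A : tensor R m n) (hA : circulant A) :
  (B0_tensor A -> pos_semidefinite A) /\ (B_tensor A -> pos_definite A).
Proof.
have m_gt0 : (0 < m)%N by apply: ltnW.
split=> [|BA x x_neq0]; first exact: B0_circulant_psd.
have [e e_gt0 B0A] := B_tensor_diag_shift m_gt0 BA.
have := B0_circulant_psd m_gt0 hev (circulant_diag_shift e hA) B0A x.
(* The shifted form being nonnegative, the form of [A] is at least [e] times the sum of the even
   powers [x 0 j ^+ m], which vanishes only at 0. *)
rewrite tensor_form_diag_shift // subr_ge0; apply: lt_le_trans.
rewrite mulr_gt0 //.
have xm_ge0 j : 0 <= x 0 j ^+ m by rewrite exprn_even_ge0.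
rewrite lt0r sumr_ge0 ?andbT //; apply/negP => /eqP sum0; apply: x_neq0.
apply/rowP => j; rewrite mxE; apply/eqP.
have /eqP : x 0 j ^+ m = 0 by apply: (psumr_eq0P (fun i _ => xm_ge0 i) sum0).
by rewrite expf_eq0 => /andP[].
Qed.
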